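(* Let $\Gamma$ be a finite interval graph. Then the right-angled Artin group $A(\overline{\Gamma})$ is a diagram group.
   Context: To a collection $\mathcal{C}$ of intervals on the real line is associated the graph $\Gamma(\mathcal{C})$ whose vertices are the elements of $\mathcal{C}$ and whose edges link two (distinct) intersecting intervals; a graph of this form is an interval graph. The complement $\overline{\Gamma}$ of a graph $\Gamma$ has the same vertices, and two distinct vertices are linked in $\overline{\Gamma}$ iff they are not linked in $\Gamma$. For a simplicial graph $\Gamma$ with vertex set $V(\Gamma)$ and edge set $E(\Gamma)$, $A(\Gamma)=\langle v\in V(\Gamma)\mid [u,v]=1,\ (u,v)\in E(\Gamma)\rangle$. A semigroup presentation $\mathcal{P}=\langle\Sigma\mid\mathcal{R}\rangle$ consists of an alphabet $\Sigma$ and a set $\mathcal{R}$ of relations $u=v$ with $u,v\in\Sigma^+$, where $\Sigma^+$ is the free semigroup of non-empty words and $\Sigma^*=\Sigma^+\cup\{1\}$ also contains the empty word. Convention: if $u=v\in\mathcal{R}$ then $v=u\notin\mathcal{R}$ (in particular $u=u\notin\mathcal{R}$). The Squier complex $S(\mathcal{P})$ is the cube complex whose vertices are the words over $\Sigma$; whose oriented edges are $(a,u\to v,b)$ with $a,b\in\Sigma^*$ and $u=v$ or $v=u$ in $\mathcal{R}$, going from $aub$ to $avb$ (and $(a,v\to u,b)$ is the same edge with opposite orientation); and whose $n$-cubes are similarly $(a_1,u_1\to v_1,\dots,a_n,u_n\to v_n,a_{n+1})$, spanned by the vertices $a_1w_1\cdots a_nw_na_{n+1}$ with $w_i\in\{u_i,v_i\}$.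 For $w\in\Sigma^+$, $S(\mathcal{P},w)$ is the connected component containing $w$, and the diagram group $D(\mathcal{P},w)$ is $\pi_1(S(\mathcal{P},w),w)$. A group is a diagram group if it is isomorphic to $D(\mathcal{P},w)$ for some semigroup presentation $\mathcal{P}$ and some $w\in\Sigma^+$. *)

(* Defs.v *)
From HB Require Import structures.
From mathcomp Require Import all_boot all_order all_algebra.
From mathcomp Require Import all_classical all_reals.
From Stdlib Require Import Relation_Operators Operators_Properties.

Set Implicit Arguments.
Unset Strict Implicit.
Unset Printing Implicit Defensive.

(* Groups are [groupType]s (arbitrary, possibly infinite groups).  Group
   presentations and fundamental groups are both obtained from a set with
   operations satisfying the group laws up to an equivalence relation. *)

Record group_setoid := GroupSetoid {
  gs_sort : choiceType;
  gs_eqv : gs_sort -> gs_sort -> Prop;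
  gs_one : gs_sort;
  gs_mul : gs_sort -> gs_sort -> gs_sort;
  gs_inv : gs_sort -> gs_sort;
  gs_refl : forall x, gs_eqv x x;
  gs_sym : forall x y, gs_eqv x y -> gs_eqv y x;
  gs_trans : forall x y z, gs_eqv x y -> gs_eqv y z -> gs_eqv x z;
  gs_mul_eqv : forall x x' y y',
    gs_eqv x x' -> gs_eqv y y' -> gs_eqv (gs_mul x y) (gs_mul x' y');
  gs_mulA : forall x y z,
    gs_eqv (gs_mul x (gs_mul y z)) (gs_mul (gs_mul x y) z);
  gs_mul1 : forall x, gs_eqv (gs_mul gs_one x) x;
  gs_mulr1 : forall x, gs_eqv (gs_mul x gs_one) x;
  gs_mulV : forall x, gs_eqv (gs_mul (gs_inv x) x) gs_one;
  gs_mulrV : forall x, gs_eqv (gs_mul x (gs_inv x)) gs_one }.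

Section GroupQuotient.
Variable S : group_setoid.
Local Open Scope quotient_scope.

Definition gs_rel : rel (gs_sort S) := fun x y => `[< gs_eqv x y >].

Lemma gs_rel_refl : reflexive gs_rel.
Proof. by move=> x; apply/asboolP; exact: gs_refl. Qed.

Lemma gs_rel_sym : symmetric gs_rel.
Proof. by move=> x y; apply/asboolP/asboolP; exact: gs_sym. Qed.

Lemma gs_rel_trans : transitive gs_rel.
Proof.
move=> y x z /asboolP xy /asboolP yz; apply/asboolP; exact: gs_trans xy yz.
Qed.

Definition gs_equiv : equiv_rel (gs_sort S) :=
  EquivRel gs_rel gs_rel_refl gs_rel_sym gs_rel_trans.

Definition group_quot := {eq_quot gs_equiv}.

HB.instance Definition _ := Choice.on group_quot.
HB.instance Definition _ := EqQuotient.on group_quot.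

Lemma gq_eqP (x y : gs_sort S) : gs_eqv x y <-> x = y %[mod group_quot].
Proof.
split=> [xy|/eqmodP/asboolP //].
by apply/eqmodP/asboolP.
Qed.

Lemma gq_repr (x : gs_sort S) : gs_eqv (repr (\pi_group_quot x)) x.
Proof. by apply/gq_eqP; rewrite reprK. Qed.

Definition gq_one : group_quot := \pi_group_quot (gs_one S).
Definition gq_mul (x y : group_quot) : group_quot :=
  \pi_group_quot (gs_mul (repr x) (repr y)).
Definition gq_inv (x : group_quot) : group_quot :=
  \pi_group_quot (gs_inv (repr x)).

Lemma gq_mulE x y :
  gq_mul (\pi_group_quot x) (\pi_group_quot y) = \pi_group_quot (gs_mul x y).
Proof. by apply/gq_eqP; apply: gs_mul_eqv; exact: gq_repr. Qed.

Lemma gs_inv_eqv (x y : gs_sort S) :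
  gs_eqv x y -> gs_eqv (gs_inv x) (gs_inv y).
Proof.
move=> xy; apply: gs_trans (gs_sym (gs_mulr1 _)) _.
apply: gs_trans (gs_mul_eqv (gs_refl _) (gs_sym (gs_mulrV y))) _.
apply: gs_trans (gs_mulA _ _ _) _.
apply: gs_trans (gs_mul_eqv _ (gs_refl _)) (gs_mul1 _).
apply: gs_trans (gs_mulV x).
exact: gs_mul_eqv (gs_refl _) (gs_sym xy).
Qed.

Lemma gq_invE x : gq_inv (\pi_group_quot x) = \pi_group_quot (gs_inv x).
Proof. by apply/gq_eqP/gs_inv_eqv; exact: gq_repr. Qed.

Lemma gq_mulA : associative gq_mul.
Proof.
elim/quotW=> x; elim/quotW=> y; elim/quotW=> z; rewrite (gq_mulE y z) (gq_mulE x y) (gq_mulE x) (gq_mulE _ z).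
by apply/gq_eqP; exact: gs_mulA.
Qed.

Lemma gq_mul1 : left_id gq_one gq_mul.
Proof. by elim/quotW=> x; rewrite gq_mulE; apply/gq_eqP/gs_mul1. Qed.

Lemma gq_mulr1 : right_id gq_one gq_mul.
Proof. by elim/quotW=> x; rewrite gq_mulE; apply/gq_eqP/gs_mulr1. Qed.

Lemma gq_mulV : left_inverse gq_one gq_inv gq_mul.
Proof. by elim/quotW=> x; rewrite gq_invE gq_mulE; apply/gq_eqP/gs_mulV. Qed.

Lemma gq_mulrV : right_inverse gq_one gq_inv gq_mul.
Proof. by elim/quotW=> x; rewrite gq_invE gq_mulE; apply/gq_eqP/gs_mulrV. Qed.

HB.instance Definition _ :=
  isGroup.Build group_quot gq_mulA gq_mul1 gq_mulr1 gq_mulV gq_mulrV.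

End GroupQuotient.

Definition group_iso (G H : groupType) : Prop :=
  exists f : {multiplicative G -> H}, bijective f.

(* The letter (x, false) stands for the generator x, (x, true) for its inverse;
   all elements of [rels] are set equal to 1. *)
Section PresentedGroup.
Variables (X : choiceType) (rels : seq (X * bool) -> Prop).
Local Notation gword := (seq (X * bool)).

Definition inv_letter (l : X * bool) : X * bool := (l.1, ~~ l.2).
Definition inv_gword (s : gword) : gword := rev (map inv_letter s).

Variant pres_step : gword -> gword -> Prop :=
| PresCancel s t l : pres_step (s ++ [:: l; inv_letter l] ++ t) (s ++ t)
| PresRel s t r of rels r : pres_step (s ++ r ++ t) (s ++ t).

Definition pres_eqv : gword -> gword -> Prop := clos_refl_sym_trans _ pres_step.

Lemma pres_eqv_cat s s' t t' :
  pres_eqv s s' -> pres_eqv t t' -> pres_eqv (s ++ t) (s' ++ t').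
Proof.
move=> ss' tt'; apply: (@rst_trans _ _ _ (s' ++ t)).
  elim: ss' => [a b ab|a|a b _|a b c _ ab _ bc].
  - apply: rst_step; case: ab => [p q l|p q r rr].
      by rewrite -!catA; exact: PresCancel.
    by rewrite -!catA; exact: PresRel.
  - exact: rst_refl.
  - exact: rst_sym.
  - exact: rst_trans ab bc.
elim: tt' => [a b ab|a|a b _|a b c _ ab _ bc].
- apply: rst_step; case: ab => [p q l|p q r rr].
    by rewrite (catA s' p) (catA s' p q); exact: PresCancel.
  by rewrite (catA s' p) (catA s' p q); exact: PresRel.
- exact: rst_refl.
- exact: rst_sym.
- exact: rst_trans ab bc.
Qed.

Lemma inv_letterK : involutive inv_letter.
Proof. by case=> x b; rewrite /inv_letter /= negbK. Qed.

Lemma inv_gwordK : involutive inv_gword.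
Proof. by move=> s; rewrite /inv_gword map_rev revK (mapK inv_letterK). Qed.

Lemma pres_mulrV s : pres_eqv (s ++ inv_gword s) [::].
Proof.
elim: s => [|l s IHs]; first exact: rst_refl.
rewrite /inv_gword map_cons rev_cons -cats1 cat_cons catA -cat1s.
apply: (@rst_trans _ _ _ ([:: l] ++ [::] ++ [:: inv_letter l])).
  apply: pres_eqv_cat; first exact: rst_refl.
  by apply: pres_eqv_cat; [exact: IHs | exact: rst_refl].
by apply: rst_step; exact: (PresCancel [::] [::] l).
Qed.

Lemma pres_mulV s : pres_eqv (inv_gword s ++ s) [::].
Proof. by rewrite -{2}(inv_gwordK s); exact: pres_mulrV. Qed.

Lemma pres_catA s t u : pres_eqv (s ++ (t ++ u)) ((s ++ t) ++ u).
Proof. by rewrite catA; exact: rst_refl. Qed.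

Lemma pres_cats0 s : pres_eqv (s ++ [::]) s.
Proof. by rewrite cats0; exact: rst_refl. Qed.

Definition presented_setoid : group_setoid :=
  @GroupSetoid gword pres_eqv [::] cat inv_gword
    (@rst_refl _ _) (@rst_sym _ _) (@rst_trans _ _) pres_eqv_cat
    pres_catA (@rst_refl _ _) pres_cats0 pres_mulV pres_mulrV.

Definition presented_group : groupType := group_quot presented_setoid.

End PresentedGroup.

Record simple_graph := SimpleGraph {
  vertex :> choiceType;
  adj : vertex -> vertex -> Prop;
  adj_sym : forall x y, adj x y -> adj y x;
  adj_irrefl : forall x, ~ adj x x }.

Definition graph_iso (G H : simple_graph) : Prop :=
  exists2 f : G -> H, bijective f & forall x y, adj x y <-> adj (f x) (f y).

Section Complement.
Variable G : simple_graph.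

Definition compl_adj (x y : G) : Prop := x <> y /\ ~ adj x y.

Lemma compl_adj_sym x y : compl_adj x y -> compl_adj y x.
Proof. by move=> [xy nxy]; split=> [/esym //|/adj_sym]. Qed.

Lemma compl_adj_irrefl x : ~ compl_adj x x.
Proof. by case. Qed.

Definition complement : simple_graph :=
  SimpleGraph compl_adj_sym compl_adj_irrefl.

End Complement.

Section IntersectionGraph.
Local Open Scope classical_set_scope.
Variables (T : Type) (C : set (set T)).

Definition meets (A B : C) : Prop := A <> B /\ val A `&` val B !=set0.

Lemma meets_sym A B : meets A B -> meets B A.
Proof. by move=> [AB AB0]; split; [exact/nesym | rewrite setIC]. Qed.

Lemma meets_irrefl A : ~ meets A A.
Proof. by case. Qed.

Definition intersection_graph : simple_graph :=
  SimpleGraph meets_sym meets_irrefl.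

End IntersectionGraph.

Definition is_interval_graph (R : realType) (G : simple_graph) : Prop :=
  exists C : set (set R),
    (forall I, C I -> exists i : interval R, I = [set` i]%classic) /\
    graph_iso G (intersection_graph C).

Definition raag_relator (G : simple_graph) (r : seq (G * bool)) : Prop :=
  exists u v : G,
    adj u v /\ r = [:: (u, false); (v, false); (u, true); (v, true)].

Definition raag (G : simple_graph) : groupType :=
  presented_group (@raag_relator G).

(* The 2-skeleton of a cube complex.  Each geometric edge gives two oriented
   edges, exchanged by [einv]; [square e1 e2 f1 f2] means that the edge paths
   e1 e2 and f1 f2 are the two halves of the boundary of a square, joining two
   opposite corners. *)
Record square_complex := SquareComplex {
  cvert : choiceType;
  cedge : choiceType;
  src : cedge -> cvert;
  tgt : cedge -> cvert;
  einv : cedge -> cedge;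
  square : cedge -> cedge -> cedge -> cedge -> Prop;
  src_einv : forall e, src (einv e) = tgt e;
  einvK : involutive einv;
  einv_neq : forall e, einv e <> e;
  square_boundary : forall e1 e2 f1 f2, square e1 e2 f1 f2 ->
    [/\ src e1 = src f1, tgt e1 = src e2, tgt f1 = src f2 & tgt e2 = tgt f2] }.

(* The fundamental group: edge loops at [x] up to homotopy, which is generated
   by removing backtracks and pushing paths across squares (cubes of dimension
   at least 3 are irrelevant). *)
Section FundamentalGroup.
Variables (K : square_complex) (x : cvert K).

Fixpoint epath (y : cvert K) (p : seq (cedge K)) (z : cvert K) : bool :=
  if p is e :: p' then (src e == y) && epath (tgt e) p' z else y == z.

Definition eloop := {p : seq (cedge K) | epath x p x}.

Variant homotopy_step : seq (cedge K) -> seq (cedge K) -> Prop :=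
| HomotopyBacktrack p q e : homotopy_step (p ++ [:: e; einv e] ++ q) (p ++ q)
| HomotopySquare p q e1 e2 f1 f2 of square e1 e2 f1 f2 :
    homotopy_step (p ++ [:: e1; e2] ++ q) (p ++ [:: f1; f2] ++ q).

Definition homotopic : eloop -> eloop -> Prop :=
  clos_refl_sym_trans _ (fun p q : eloop => homotopy_step (val p) (val q)).

Definition inv_path (p : seq (cedge K)) : seq (cedge K) :=
  rev (map (@einv K) p).

Lemma tgt_einv (e : cedge K) : tgt (einv e) = src e.
Proof. by rewrite -src_einv einvK. Qed.

Lemma epath_cat y z t p q : epath y p z -> epath z q t -> epath y (p ++ q) t.
Proof.
elim: p y => [|e p IHp] y /=; first by move/eqP->.
by case/andP=> -> /IHp /[apply].
Qed.

Lemma epath_inv y z p : epath y p z -> epath z (inv_path p) y.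
Proof.
elim: p y => [|e p IHp] y /=; first by rewrite eq_sym.
case/andP=> /eqP ey /IHp ep.
rewrite /inv_path map_cons rev_cons -cats1; apply: epath_cat ep _ => /=.
by rewrite src_einv tgt_einv ey !eqxx.
Qed.

Definition loop_one : eloop := Sub [::] (eqxx x).
Definition loop_mul (p q : eloop) : eloop :=
  Sub (val p ++ val q) (epath_cat (valP p) (valP q)).
Definition loop_inv (p : eloop) : eloop :=
  Sub (inv_path (val p)) (epath_inv (valP p)).

Lemma homotopic_mul p p' q q' : homotopic p p' -> homotopic q q' ->
  homotopic (loop_mul p q) (loop_mul p' q').
Proof.
move=> pp' qq'; apply: (@rst_trans _ _ _ (loop_mul p' q)).
  elim: pp' => [a b ab|a|a b _|a b c _ ab _ bc].
  - apply: rst_step => /=; case: ab => [s t e|s t e1 e2 f1 f2 sq].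
      by rewrite -!catA; exact: HomotopyBacktrack.
    by rewrite -!catA; exact: HomotopySquare.
  - exact: rst_refl.
  - exact: rst_sym.
  - exact: rst_trans ab bc.
elim: qq' => [a b ab|a|a b _|a b c _ ab _ bc].
- apply: rst_step => /=; case: ab => [s t e|s t e1 e2 f1 f2 sq].
    by rewrite (catA _ s) (catA _ s t); exact: HomotopyBacktrack.
  by rewrite !(catA _ s); exact: HomotopySquare.
- exact: rst_refl.
- exact: rst_sym.
- exact: rst_trans ab bc.
Qed.

Lemma homotopic_val (p q : eloop) : val p = val q -> homotopic p q.
Proof. by move/val_inj->; exact: rst_refl. Qed.

Lemma homotopic_mulA p q r :
  homotopic (loop_mul p (loop_mul q r)) (loop_mul (loop_mul p q) r).
Proof. by apply: homotopic_val; rewrite /= catA. Qed.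

Lemma homotopic_mul1 p : homotopic (loop_mul loop_one p) p.
Proof. exact: homotopic_val. Qed.

Lemma homotopic_mulr1 p : homotopic (loop_mul p loop_one) p.
Proof. by apply: homotopic_val; rewrite /= cats0. Qed.

Lemma inv_pathK : involutive inv_path.
Proof. by move=> p; rewrite /inv_path map_rev revK (mapK (@einvK K)). Qed.

Lemma epath_catE y z p q :
  epath y (p ++ q) z -> exists2 t, epath y p t & epath t q z.
Proof.
elim: p y => [|e p IHp] y /=; first by move=> yqz; exists y; rewrite ?eqxx.
by case/andP=> -> /IHp[t pt tq]; exists t.
Qed.

Lemma homotopic_path_inv p z : epath x p z ->
  forall h : epath x (p ++ inv_path p) x, homotopic (exist _ (p ++ inv_path p) h) loop_one.
Proof.
elim/last_ind: p z => [|p e IHp] z; first by move=> _ h; exact: homotopic_val.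
rewrite -cats1 => /epath_catE[t xpt _] h.
have h' : epath x (p ++ inv_path p) x.
  exact: epath_cat xpt (epath_inv xpt).
apply: (@rst_trans _ _ _ (exist _ (p ++ inv_path p) h' : eloop)); last exact: IHp xpt h'.
apply: rst_step => /=.
rewrite -catA {1}/inv_path map_cat rev_cat.
exact: (HomotopyBacktrack p (inv_path p) e).
Qed.

Lemma homotopic_mulrV p : homotopic (loop_mul p (loop_inv p)) loop_one.
Proof.
apply: rst_trans (homotopic_path_inv (valP p) (valP (loop_mul p (loop_inv p)))).
exact: homotopic_val.
Qed.

Lemma homotopic_mulV p : homotopic (loop_mul (loop_inv p) p) loop_one.
Proof.
apply: rst_trans (homotopic_mulrV (loop_inv p)).
by apply: homotopic_val; rewrite /= inv_pathK.
Qed.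

Definition loop_setoid : group_setoid :=
  @GroupSetoid eloop homotopic loop_one loop_mul loop_inv
    (@rst_refl _ _) (@rst_sym _ _) (@rst_trans _ _) homotopic_mul
    homotopic_mulA homotopic_mul1 homotopic_mulr1
    homotopic_mulV homotopic_mulrV.

Definition fundamental_group : groupType := group_quot loop_setoid.

End FundamentalGroup.

Record semigroup_presentation := SemigroupPresentation {
  alphabet : choiceType;
  srel : seq alphabet -> seq alphabet -> Prop;
  srel_nonempty : forall u v, srel u v -> u <> [::] /\ v <> [::];
  srel_asym : forall u v, srel u v -> ~ srel v u }.

Section SquierComplex.
Variable P : semigroup_presentation.
Local Notation word := (seq (alphabet P)).

Definition rewrites (u v : word) : Prop := srel u v \/ srel v u.

(* The oriented edge (a, u -> v, b) is encoded by the tuple (a, u, v, b). *)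
Definition is_squier_edge (e : word * word * word * word) : bool :=
  let: (a, u, v, b) := e in `[< rewrites u v >].

Definition squier_edge := {e | is_squier_edge e}.

Definition squier_src (e : squier_edge) : word :=
  let: (a, u, v, b) := val e in a ++ u ++ b.

Definition squier_tgt (e : squier_edge) : word :=
  let: (a, u, v, b) := val e in a ++ v ++ b.

Definition flip_edge (e : word * word * word * word) :=
  let: (a, u, v, b) := e in (a, v, u, b).

Lemma flip_edgeP e : is_squier_edge e -> is_squier_edge (flip_edge e).
Proof.
by case: e => [[[a u] v] b] /asboolP uv; apply/asboolP; case: uv; [right|left].
Qed.

Definition squier_inv (e : squier_edge) : squier_edge :=
  Sub (flip_edge (val e)) (flip_edgeP (valP e)).

(* The square (a1, u1 -> v1, a2, u2 -> v2, a3). *)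
Definition squier_square (e1 e2 f1 f2 : squier_edge) : Prop :=
  exists a1 u1 v1 a2 u2 v2 a3,
    [/\ val e1 = (a1, u1, v1, a2 ++ u2 ++ a3),
        val e2 = (a1 ++ v1 ++ a2, u2, v2, a3),
        val f1 = (a1 ++ u1 ++ a2, u2, v2, a3) &
        val f2 = (a1, u1, v1, a2 ++ v2 ++ a3)].

Lemma squier_src_inv e : squier_src (squier_inv e) = squier_tgt e.
Proof. by case: e => [[[[a u] v] b] uv]. Qed.

Lemma squier_invK : involutive squier_inv.
Proof. by case=> [[[[a u] v] b] uv]; exact: val_inj. Qed.

Lemma squier_inv_neq e : squier_inv e <> e.
Proof.
case: e => [[[[a u] v] b] uv] /(congr1 val)[vu _]; move/asboolP: uv.
by rewrite vu; case=> uu; exact: (srel_asym uu).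
Qed.

Lemma squier_square_boundary e1 e2 f1 f2 : squier_square e1 e2 f1 f2 ->
  [/\ squier_src e1 = squier_src f1, squier_tgt e1 = squier_src e2,
      squier_tgt f1 = squier_src f2 & squier_tgt e2 = squier_tgt f2].
Proof.
move=> [a1 [u1 [v1 [a2 [u2 [v2 [a3 [E1 E2 F1 F2]]]]]]]].
by rewrite /squier_src /squier_tgt E1 E2 F1 F2 -!catA.
Qed.

Definition squier_complex : square_complex :=
  SquareComplex squier_src_inv squier_invK squier_inv_neq
    squier_square_boundary.

(* Edge loops based at [w] stay in the component of [w], so there is no need to
   restrict to it. *)
Definition diagram_group (w : word) : groupType :=
  @fundamental_group squier_complex w.

End SquierComplex.

Definition is_diagram_group (G : groupType) : Prop :=
  exists (P : semigroup_presentation) (w : seq (alphabet P)),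
    w <> [::] /\ group_iso G (diagram_group w).

(* Main.v *)
(** Cut the real line at finitely many points witnessing all intersections of
    intervals: the vertices of [G] become factors [mid x] of one word [w] with
    pairwise distinct letters, and [x], [y] are adjacent in the complement iff
    [mid x] and [mid y] occupy disjoint positions of [w].  For each vertex [x],
    attach to [mid x] a triangle of relations through two new letters.  Going once
    around the triangle inside [w] is a loop, and disjoint factors give commuting
    loops, which yields a morphism from A(complement of G) to the diagram group.
    Conversely, reading off the sides of the triangles joining two new letters
    sends homotopic loops to equal elements.  For the bijectivity, [expand]
    replaces each new letter of [x] by [mid x]; it is constant along edges, so
    every word [z] in the component of [w] comes with a preferred path
    [expansion z] to [w], and by the interchange law conjugating any edge by these
    preferred paths gives a trivial loop or a generator. *)

From HB Require Import structures.
Require Import Defs.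
From mathcomp Require Import all_boot all_order all_algebra.
From mathcomp Require Import all_classical all_reals.
From Stdlib Require Import Relation_Operators.

Set Implicit Arguments.
Unset Strict Implicit.
Unset Printing Implicit Defensive.

Import Order.TTheory.

(** * Factors of words *)

Section Factors.
Local Open Scope order_scope.

Lemma filter_convex_factor d (T : orderType d) (P : pred T) (s : seq T) :
  sorted <=%O s ->
  (forall x y z, P x -> P z -> x <= y <= z -> P y) ->
  exists a b, s = a ++ seq.filter P s ++ b.
Proof.
move=> s_sorted Pconv.
(* The induction also needs the prefix to avoid [P]: when the new head satisfies [P] and the filter
   is nonempty, a letter of the prefix would lie between two elements of [P], so the prefix is
   empty. *)
suff [a [b [sE _]]] : exists a b, s = a ++ seq.filter P s ++ b /\ ~~ has P a.
  by exists a, b.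
elim: s s_sorted => [_|x s IHs xs_sorted]; first by exists [::], [::].
have [a [b [sE aP]]] := IHs (path_sorted xs_sorted).
rewrite /=; case: ifP => [Px|nPx]; last first.
  by exists (x :: a), b; rewrite /= nPx -sE.
exists [::]; case fE: (seq.filter P s) sE => [|z f] sE; first by exists s.
exists b; split => //; congr (_ :: _); rewrite {1}sE.
case: a aP sE => // y a /norP[nPy _] sE; case/negP: nPy.
move: xs_sorted; rewrite /= sE /= => /andP[xy /(order_path_min le_trans)/allP ya].
apply: (Pconv x _ z) => //.
  have : z \in seq.filter P s by rewrite fE inE eqxx.
  by rewrite mem_filter => /andP[].
by rewrite xy ya// mem_cat inE eqxx orbT.
Qed.

(** The first letter of [m] occurs only once, and its index is both [size p] and [size p']. *)
Lemma uniq_factor (T : eqType) (m p q p' q' : seq T) :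
  m <> [::] -> uniq (p ++ m ++ q) -> p ++ m ++ q = p' ++ m ++ q' ->
  p = p' /\ q = q'.
Proof.
case: m => // x m _ u E.
have pE : p = p'.
  have sz : size p = size p'.
    rewrite -[size p](_ : index x (p ++ (x :: m) ++ q) = _); last first.
      rewrite index_cat /= eqxx addn0; case: ifP => // xp.
      by move: u; rewrite cat_uniq => /and3P[_ /hasPn/(_ x)]; rewrite inE eqxx xp => /(_ isT).
    move: u; rewrite E => u; rewrite index_cat /= eqxx addn0; case: ifP => // xp.
    by move: u; rewrite cat_uniq => /and3P[_ /hasPn/(_ x)]; rewrite inE eqxx xp => /(_ isT).
  by move/eqP: E; rewrite eqseq_cat// => /andP[/eqP].
split=> //; move/eqP: E; rewrite pE eqseq_cat// => /andP[_].
by rewrite eqseq_cat// => /andP[_ /eqP].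
Qed.

Lemma cat_eq_cat (T : eqType) (p r p' r' : seq T) :
  p ++ r = p' ++ r' -> (size p <= size p')%N ->
  exists2 t, p' = p ++ t & r = t ++ r'.
Proof.
elim: p p' => [|x p IHp] [|y p'] //=; first by move=> -> _; exists [::].
  by move=> E _; exists (y :: p').
by case=> -> /IHp E /E[t -> ->]; exists t.
Qed.

(** If [m'] started before the end of [m], its first letter would lie in [m]. *)
Lemma disjoint_factors (T : eqType) (p m q p' m' q' : seq T) :
  m' <> [::] -> ~~ has (mem m) m' -> p ++ m ++ q = p' ++ m' ++ q' ->
  (size p <= size p')%N ->
  exists r, p' = p ++ m ++ r /\ q = r ++ m' ++ q'.
Proof.
move=> m'0 mm' E /(cat_eq_cat E)[t -> E'].
have [mt|] := leqP (size m) (size t).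
  by have [r -> ->] := cat_eq_cat E' mt; exists r; rewrite catA.
move=> tm; have [[|y r] mE E''] := cat_eq_cat (esym E') (ltnW tm).
  by move: tm; rewrite mE cats0 ltnn.
case: m' m'0 mm' {E E'} E'' => // z m' _ mm' [yz _].
by move: mm'; rewrite mE /= mem_cat inE yz eqxx orbT.
Qed.

End Factors.

(** * Interval graphs as overlap graphs of factors of a word *)

Lemma interval_graph_factors (R : realType) (G : simple_graph) :
  finite_set [set: G]%classic -> is_interval_graph R G ->
  exists (A : choiceType) (w : seq A) (pre mid suf : G -> seq A),
    [/\ uniq w, w <> [::], forall x, mid x <> [::],
        forall x, pre x ++ mid x ++ suf x = w &
        forall x y, x <> y -> (adj x y <-> has (mem (mid x)) (mid y))].
Proof.
move=> /finite_seqP[vs vsE] [C [Citv [f f_bij f_adj]]].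
have vsP x : x \in vs.
  by have : [set: G]%classic x by []; rewrite vsE.
pose I x : set R := val (f x).
have I_conv x p q r : I x p -> I x r -> (p <= q <= r)%O -> I x q.
  have [i iE] := Citv (val (f x)) (set_valP (f x)).
  rewrite /I iE /=; case: i {iE} => a b; rewrite !itv_boundlr.
  move=> /andP[ap _] /andP[_ rb] /andP[pq qr].
  by apply/andP; split; [apply: le_trans ap _|apply: le_trans rb]; rewrite bnd_simp.
have I_inj x y : I x = I y -> x = y.
  by move=> /val_inj /(bij_inj f_bij).
(* For disjoint [I x] and [I y] this is the default 0; an extra cut point is harmless, as [mid x]
   keeps only points that lie in [I x]. *)
pose point x y : R := xget 0%R (I x `&` I y)%classic.
have pointP x y : (I x `&` I y !=set0)%classic -> I x (point x y) /\ I y (point x y).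
  by move=> ne; exact: (xgetPex 0%R ne).
pose pts := sort <=%O (undup [seq point x y | x <- vs, y <- vs]).
have pts_point x y : point x y \in pts.
  by rewrite mem_sort mem_undup; apply/allpairsP; exists (x, y); rewrite !vsP.
pose inI x (p : R) := `[< I x p >].
(* The empty interval may be a vertex; it gets the extra final letter [None]. *)
pose empty x := `[< I x = set0 >].
pose mid x : seq (option R) :=
  if empty x then [:: None] else map Some (seq.filter (inI x) pts).
have factor x : exists ps, ps.1 ++ mid x ++ ps.2 = rcons (map Some pts) None.
  rewrite /mid; case: ifP => _.
    by exists (map Some pts, [::]); rewrite cats1.
  have [|p q r /asboolP Ip /asboolP Ir pqr|a [b ptsE]] :=
      @filter_convex_factor _ R (inI x) pts _ _.
  - by apply: sort_sorted => p q; exact: le_total.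
  - by apply/asboolP; exact: I_conv Ip Ir pqr.
  - exists (map Some a, rcons (map Some b) None).
    by rewrite [in RHS]ptsE !map_cat !rcons_cat.
have [ps psE] := choice factor.
exists (option R), (rcons (map Some pts) None), (fst \o ps), mid, (snd \o ps).
have mem_mid x y : ~~ empty x -> I x (point x y) -> Some (point x y) \in mid x.
  move=> /negbTE nx xp; rewrite /mid nx mem_map; last by move=> ? ? [].
  by rewrite mem_filter pts_point andbT; apply/asboolP.
have nonempty x : ~~ empty x -> (I x !=set0)%classic.
  by move=> /asboolP/eqP/set0P.
split.
- rewrite rcons_uniq map_inj_uniq ?sort_uniq ?undup_uniq ?andbT; last by move=> ? ? [].
  by apply/mapP => -[].
- by case: (map Some pts).
- move=> x; have [ex|nx] := boolP (empty x); first by rewrite /mid ex.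
  (* The diagonal points [point x x] make [mid x] nonempty even when [x] is an isolated vertex. *)
  have [|xx _] := pointP x x; first by rewrite setIid; exact: nonempty.
  by have := mem_mid x x nx xx; case: (mid x).
- by move=> x; rewrite /= psE.
move=> x y xy; rewrite f_adj; split=> [[_ xy0]|/hasP[[p|]]].
- have [xp yp] := pointP x y xy0.
  have nx : ~~ empty x by apply/asboolP => x0; move: xp; rewrite x0.
  have ny : ~~ empty y by apply/asboolP => y0; move: yp; rewrite y0.
  apply/hasP; exists (Some (point x y)); last exact: mem_mid.
  rewrite /mid (negbTE ny) mem_map; last by move=> ? ? [].
  by rewrite mem_filter pts_point andbT; apply/asboolP.
- rewrite /= /mid; case: ifP => // _; rewrite mem_map; last by move=> ? ? [].
  rewrite mem_filter => /andP[/asboolP yp _].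
  case: ifP => // _; rewrite mem_map; last by move=> ? ? [].
  rewrite mem_filter => /andP[/asboolP xp _].
  split; last by exists p.
  by move=> /(congr1 val)/I_inj.
(* A shared [None] makes both intervals empty, but the set [C] has at most one empty member. *)
- have none z : None \in mid z -> I z = set0.
    by rewrite /mid; case: ifP => [/asboolP//|_ /mapP[]].
  by move=> /none y0 /none x0; case: xy; apply: I_inj; rewrite x0 y0.
Qed.

(** * Isomorphisms of quotient groups given on representatives *)

Lemma group_quot_iso (S T : group_setoid) (F : gs_sort S -> gs_sort T)
    (F' : gs_sort T -> gs_sort S) :
  (forall s s', gs_eqv s s' -> gs_eqv (F s) (F s')) ->
  (forall t t', gs_eqv t t' -> gs_eqv (F' t) (F' t')) ->
  (forall s s', gs_eqv (F (gs_mul s s')) (gs_mul (F s) (F s'))) ->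
  (forall s, gs_eqv (F' (F s)) s) -> (forall t, gs_eqv (F (F' t)) t) ->
  group_iso (group_quot S) (group_quot T).
Proof.
move=> F_eqv F'_eqv F_mul FK F'K.
pose f (a : group_quot S) : group_quot T := (\pi_(group_quot T) (F (repr a)))%qT.
pose f' (b : group_quot T) : group_quot S := (\pi_(group_quot S) (F' (repr b)))%qT.
have fE s : f (\pi_(group_quot S) s)%qT = (\pi_(group_quot T) (F s))%qT.
  by apply/gq_eqP/F_eqv/gq_repr.
have f'E t : f' (\pi_(group_quot T) t)%qT = (\pi_(group_quot S) (F' t))%qT.
  by apply/gq_eqP/F'_eqv/gq_repr.
have f_mul : {morph f : a b / (a * b)%g >-> (a * b)%g}.
  elim/quotW=> a; elim/quotW=> b.
  rewrite -[(_ * _)%g in LHS]/(gq_mul _ _) -[(_ * _)%g in RHS]/(gq_mul _ _).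
  by rewrite gq_mulE !fE gq_mulE; apply/gq_eqP/F_mul.
pose fM := isMultiplicative.Build _ _ f f_mul.
pose fm : {multiplicative group_quot S -> group_quot T} := HB.pack f fM.
exists fm; exists f'.
  by elim/quotW=> s; rewrite /= fE f'E; apply/gq_eqP/FK.
by elim/quotW=> t; rewrite /= f'E fE; apply/gq_eqP/F'K.
Qed.

(** * Homotopy of edge paths relative to their endpoints *)

Section PathHomotopy.
Variable K : square_complex.
Implicit Types (x y z t : cvert K) (p q r : seq (cedge K)).

(* Homotopy of edge paths with fixed endpoints.  Requiring both sides of each
   step to be paths excludes backtracks inserted at unrelated vertices. *)
Definition path_step y z p q := [/\ epath y p z, epath y q z & homotopy_step p q].
Definition path_homotopic y z := clos_refl_sym_trans _ (path_step y z).

Lemma epath_cons y z e p : epath y (e :: p) z = (src e == y) && epath (tgt e) p z.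
Proof. by []. Qed.

Lemma epath_nil y z : epath y [::] z = (y == z).
Proof. by []. Qed.

Lemma epath_catP y z p q :
  reflect (exists2 t, epath y p t & epath t q z) (epath y (p ++ q) z).
Proof.
by apply: (iffP idP) => [/epath_catE //|[t yt tz]]; exact: epath_cat yt tz.
Qed.

Lemma path_homotopic_epath y z p q :
  path_homotopic y z p q -> epath y p z = epath y q z.
Proof. by elim=> {p q} [p q [-> ->]|//|p q _ ->|p q r _ -> _ ->]. Qed.

Lemma path_homotopic_whisker x y z t p q r r' :
  epath x r y -> epath z r' t -> path_homotopic y z p q ->
  path_homotopic x t (r ++ p ++ r') (r ++ q ++ r').
Proof.
move=> xy zt; elim=> {p q} [p q [yp yq pq]|p|p q _ pq|p q s _ pq _ qs].
- apply: rst_step; split.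
  + exact: epath_cat xy (epath_cat yp zt).
  + exact: epath_cat xy (epath_cat yq zt).
  + by case: pq => [a b e|a b e1 e2 f1 f2 sq]; rewrite -!catA !(catA r a);
      [exact: HomotopyBacktrack | exact: HomotopySquare].
- exact: rst_refl.
- exact: rst_sym.
- exact: rst_trans pq qs.
Qed.

Lemma path_homotopic_catl y z t p q r :
  epath y r z -> path_homotopic z t p q -> path_homotopic y t (r ++ p) (r ++ q).
Proof.
by move=> yz /(path_homotopic_whisker yz (eqxx t : epath t [::] t)); rewrite !cats0.
Qed.

Lemma path_homotopic_catr y z t p q r :
  epath z r t -> path_homotopic y z p q -> path_homotopic y t (p ++ r) (q ++ r).
Proof. by move=> zt; exact: (path_homotopic_whisker (eqxx y : epath y [::] y)). Qed.

Lemma path_homotopic_backtrack x z p e q :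
  epath x p (src e) -> epath (src e) q z ->
  path_homotopic x z (p ++ [:: e; einv e] ++ q) (p ++ q).
Proof.
move=> xe ez; apply: rst_step; split.
- by apply: epath_cat xe _; rewrite /= src_einv tgt_einv !eqxx.
- exact: epath_cat xe ez.
- exact: HomotopyBacktrack.
Qed.

Lemma path_homotopic_inv x y p : epath x p y -> path_homotopic x x (p ++ inv_path p) [::].
Proof.
(* Peeling [p] from its end exposes the backtrack in the middle of [p ++ inv_path p]. *)
elim/last_ind: p y => [|p e IHp] y; first by move=> _; exact: rst_refl.
rewrite -cats1 => /epath_catP[t xt /= /andP[/eqP te _]].
rewrite -{}te in xt.
apply: rst_trans (IHp _ xt); rewrite -catA /inv_path map_cat rev_cat.
exact: path_homotopic_backtrack xt (epath_inv xt).
Qed.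

(** Returns to the homotopy that defines the fundamental group: every intermediate path is again a
    loop at [x]. *)
Lemma path_homotopic_loop x (p q : eloop x) :
  path_homotopic x x (val p) (val q) -> homotopic p q.
Proof.
suff H r s : path_homotopic x x r s -> forall (hr : epath x r x) (hs : epath x s x),
    homotopic (exist _ r hr : eloop x) (exist _ s hs).
  by case: p q => [p xp] [q xq] pq; exact: H.
elim=> {p q r s} [r s [_ _ rs]|r|r s _ rs|r s t rs IHrs st IHst] hr hs.
- exact: rst_step.
- exact: homotopic_val.
- by apply: rst_sym; exact: rs.
- have ht : epath x s x by rewrite (path_homotopic_epath st).
  exact: rst_trans (IHrs hr ht) (IHst ht hs).
Qed.

End PathHomotopy.

(** * The two-sided action of words on the Squier complex, and the interchange law *)

Section Whiskering.
Variable P : semigroup_presentation.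
Local Notation word := (seq (alphabet P)).
Local Notation K := (squier_complex P).
Local Notation epath := (@epath K).
Local Notation path_homotopic := (@path_homotopic K).
Implicit Types (a b c d y z : word) (p q : seq (cedge K)).

Definition whisker_tuple a b (e : word * word * word * word) :=
  let: (a', u, v, b') := e in (a ++ a', u, v, b' ++ b).

Lemma whisker_tupleP a b e : is_squier_edge e -> is_squier_edge (whisker_tuple a b e).
Proof. by case: e => [[[]]]. Qed.

Definition whisker a b (e : cedge K) : cedge K :=
  Sub (whisker_tuple a b (val e)) (whisker_tupleP a b (valP e)).

Definition whiskerp a b p : seq (cedge K) := map (whisker a b) p.

Lemma src_whisker a b e : src (whisker a b e) = a ++ src e ++ b.
Proof. by case: e => [[[[? ?] ?] ?] ?]; rewrite /= /squier_src /= -!catA. Qed.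

Lemma tgt_whisker a b e : tgt (whisker a b e) = a ++ tgt e ++ b.
Proof. by case: e => [[[[? ?] ?] ?] ?]; rewrite /= /squier_tgt /= -!catA. Qed.

Lemma whisker0 e : whisker [::] [::] e = e.
Proof. by case: e => [[[[? ?] ?] ?] ?]; apply: val_inj; rewrite /= cats0. Qed.

Lemma whisker_comp a b c d e : whisker a b (whisker c d e) = whisker (a ++ c) (d ++ b) e.
Proof. by case: e => [[[[? ?] ?] ?] ?]; apply: val_inj; rewrite /= !catA. Qed.

Lemma whisker_inv a b e : einv (whisker a b e) = whisker a b (einv e).
Proof. by case: e => [[[[? ?] ?] ?] ?]; apply: val_inj. Qed.

Lemma whiskerp0 p : whiskerp [::] [::] p = p.
Proof. by rewrite /whiskerp -[RHS]map_id; apply: eq_map => e; exact: whisker0. Qed.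

Lemma whiskerp_comp a b c d p :
  whiskerp a b (whiskerp c d p) = whiskerp (a ++ c) (d ++ b) p.
Proof. by rewrite /whiskerp -map_comp; apply: eq_map => e; exact: whisker_comp. Qed.

Lemma whiskerp_inv a b p : inv_path (whiskerp a b p) = whiskerp a b (inv_path p).
Proof.
rewrite /inv_path /whiskerp map_rev -!map_comp; congr rev.
by apply: eq_map => e; exact: whisker_inv.
Qed.

Lemma whiskerp_cat a b p q : whiskerp a b (p ++ q) = whiskerp a b p ++ whiskerp a b q.
Proof. exact: map_cat. Qed.

Lemma epath_whisker a b y z p :
  epath y p z -> epath (a ++ y ++ b) (whiskerp a b p) (a ++ z ++ b).
Proof.
elim: p y => [|e p IHp] y; first by move=> /eqP ->; rewrite /= eqxx.
move=> /andP[/eqP <- /IHp]; rewrite -tgt_whisker => ep; apply/andP; split=> //.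
by rewrite src_whisker.
Qed.

Lemma homotopic_whisker a b y z p q : path_homotopic y z p q ->
  path_homotopic (a ++ y ++ b) (a ++ z ++ b) (whiskerp a b p) (whiskerp a b q).
Proof.
elim=> {p q} [p q [yp yq pq]|p|p q _ pq|p q s _ pq _ qs].
- apply: rst_step; split; [exact: epath_whisker|exact: epath_whisker|].
  case: pq => [p' q' e|p' q' e1 e2 f1 f2 [a1 [u1 [v1 [a2 [u2 [v2 [a3 [E1 E2 F1 F2]]]]]]]]].
    rewrite !whiskerp_cat [whiskerp _ _ [:: _; _]]/= -whisker_inv.
    exact: HomotopyBacktrack.
  rewrite !whiskerp_cat [whiskerp _ _ [:: e1; _]]/= [whiskerp _ _ [:: f1; _]]/=.
  apply: HomotopySquare; exists (a ++ a1), u1, v1, a2, u2, v2, (a3 ++ b).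
  by rewrite /= E1 E2 F1 F2 /= !catA.
- exact: rst_refl.
- exact: rst_sym.
- exact: rst_trans pq qs.
Qed.

(** The two sides are the halves of the boundary of one square, whose middle word joins the right
    context of [e] to the left context of [f]. *)
Lemma edge_interchange (e f : cedge K) :
  path_homotopic (src e ++ src f) (tgt e ++ tgt f)
    [:: whisker [::] (src f) e; whisker (tgt e) [::] f]
    [:: whisker (src e) [::] f; whisker [::] (tgt f) e].
Proof.
apply: rst_step; split.
- by rewrite !epath_cons epath_nil !src_whisker !tgt_whisker !cats0 !eqxx.
- by rewrite !epath_cons epath_nil !src_whisker !tgt_whisker !cats0 !eqxx.
apply: (@HomotopySquare K [::] [::]).
case: e f => [[[[a1 u1] v1] b1] h1] [[[[a2 u2] v2] b2] h2].
exists a1, u1, v1, (b1 ++ a2), u2, v2, b2.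
by rewrite /= /squier_src /squier_tgt /= !cats0 -!catA.
Qed.

(** The rectangle spanned by [p] and [q] is tiled by the squares of [edge_interchange]. *)
Lemma interchange y y' z z' p q : epath y p y' -> epath z q z' ->
  path_homotopic (y ++ z) (y' ++ z')
    (whiskerp [::] z p ++ whiskerp y' [::] q)
    (whiskerp y [::] q ++ whiskerp [::] z' p).
Proof.
move=> yp zq; elim: p y yp => [|e p IHp] y.
  by move=> /eqP ->; rewrite /= cats0; exact: rst_refl.
move=> /andP[/eqP <- ep]; have {IHp} := IHp _ ep.
(* One row of the rectangle: a single edge of [p] against all of [q]. *)
have e_q : path_homotopic (src e ++ z) (tgt e ++ z')
    (whisker [::] z e :: whiskerp (tgt e) [::] q)
    (whiskerp (src e) [::] q ++ [:: whisker [::] z' e]).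
  elim: q z zq {ep} => [|f q IHq] z.
    by move=> /eqP ->; exact: rst_refl.
  move=> /andP[/eqP <- fq]; have {}IHq := IHq _ fq.
  apply: rst_trans (_ : path_homotopic _ _ _ (whisker (src e) [::] f ::
     whisker [::] (tgt f) e :: whiskerp (tgt e) [::] q)) _.
    have := epath_whisker (tgt e) [::] fq; rewrite !cats0 => {}fq.
    exact: (path_homotopic_catr fq (edge_interchange e f)).
  apply: (path_homotopic_catl (r := [:: _]) _ IHq).
  by rewrite epath_cons epath_nil src_whisker tgt_whisker !cats0 !eqxx.
move=> IHp; apply: rst_trans (_ : path_homotopic _ _ _ (whisker [::] z e ::
  whiskerp (tgt e) [::] q ++ whiskerp [::] z' p)) _.
  apply: (path_homotopic_catl (r := [:: _]) _ IHp).
  by rewrite epath_cons epath_nil src_whisker tgt_whisker !eqxx.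
have {}ep := epath_whisker [::] z' ep.
have := path_homotopic_catr ep e_q.
by rewrite -[_ ++ _ :: _]/(_ ++ [:: _] ++ _) -catA.
Qed.

End Whiskering.

(** * The semigroup presentation attached to a family of factors *)

Section FactorPresentation.
Variables (A : choiceType) (D : simple_graph) (w : seq A) (pre mid suf : D -> seq A).
Hypotheses (w_uniq : uniq w) (mid_nonempty : forall x, mid x <> [::])
  (factorE : forall x, pre x ++ mid x ++ suf x = w)
  (adjE : forall x y, adj x y <-> ~~ has (mem (mid x)) (mid y)).

Local Notation letter := (A + D * bool)%type.
Local Notation word := (seq letter).
Local Notation gword := (seq (D * bool)).
Implicit Types (a b u v y z : word) (x : D) (s : bool) (l : D * bool).

Definition base_word (m : seq A) : word := map inl m.
Local Notation W := (base_word w).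
Local Notation M x := (base_word (mid x)).

(* The three relations at [x] form a triangle [M x], [(x, false)], [(x, true)] in
   the Squier complex: a circle, since relations [u = u] and double relations are
   not allowed. *)
Variant factor_rel : word -> word -> Prop :=
| FactorCollapse x s : factor_rel (M x) [:: inr (x, s)]
| FactorCross x : factor_rel [:: inr (x, false)] [:: inr (x, true)].

Lemma factor_rel_nonempty u v : factor_rel u v -> u <> [::] /\ v <> [::].
Proof. by case=> // x s; split=> //; case: (mid x) (mid_nonempty (x := x)). Qed.

(** Numbers the corners [M x], [(x, false)], [(x, true)] of a triangle 0, 1, 2; every relation goes
    upwards, so none holds in both directions. *)
Definition word_rank (u : word) : nat := if u is [:: inr (_, s)] then s.+1 else 0.

Lemma word_rank_lt u v : factor_rel u v -> word_rank u < word_rank v.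
Proof. by case=> // x s; case: (mid x) => [|? []]. Qed.

Lemma factor_rel_asym u v : factor_rel u v -> ~ factor_rel v u.
Proof. by move=> /word_rank_lt/ltnW; rewrite leqNgt => /negP uv /word_rank_lt. Qed.

Definition factor_presentation : semigroup_presentation :=
  SemigroupPresentation factor_rel_nonempty factor_rel_asym.

Local Notation P := factor_presentation.
Local Notation K := (squier_complex P).
Local Notation epath := (@epath K).
Local Notation path_homotopic := (@path_homotopic K).
Local Notation whisker := (@whisker P).
Local Notation whiskerp := (@whiskerp P).
Implicit Types (e : cedge K) (p q : seq (cedge K)).

Lemma collapse_subproof x s : @is_squier_edge P ([::], M x, [:: inr (x, s)], [::]).
Proof. by apply/asboolP; left; exact: FactorCollapse. Qed.

Definition collapse x s : cedge K := Sub _ (collapse_subproof x s).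

Lemma cross_subproof x s :
  @is_squier_edge P ([::], [:: inr (x, s)], [:: inr (x, ~~ s)], [::]).
Proof.
by apply/asboolP; case: s; [right|left]; exact: FactorCross.
Qed.

Definition cross x s : cedge K := Sub _ (cross_subproof x s).

Lemma cross_inv x s : einv (cross x s) = cross x (~~ s).
Proof. by apply: val_inj; rewrite /= negbK. Qed.

(** Only [collapse] needs a separate case for its inverse: that of [cross x s] is
    [cross x (~~ s)]. *)
Variant edge_spec : cedge K -> Prop :=
| EdgeCollapse a b x s : edge_spec (whisker a b (collapse x s))
| EdgeExpand a b x s : edge_spec (whisker a b (einv (collapse x s)))
| EdgeCross a b x s : edge_spec (whisker a b (cross x s)).

Lemma edgeP e : edge_spec e.
Proof.
have spec e' : val e' = val e -> edge_spec e' -> edge_spec e by move=> /val_inj ->.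
case: (val e) (valP e) spec => [[[a u] v] b] /asboolP[] [x s|x] spec.
- by apply: spec (EdgeCollapse a b x s); rewrite /= cats0.
- by apply: spec (EdgeCross a b x false); rewrite /= cats0.
- by apply: spec (EdgeExpand a b x s); rewrite /= cats0.
- by apply: spec (EdgeCross a b x true); rewrite /= cats0.
Qed.

(** * Expansion of words and the preferred paths *)

Definition expand_letter (c : letter) : word :=
  match c with inl i => [:: inl i] | inr l => M l.1 end.

Definition expand (z : word) : word := flatten (map expand_letter z).

Lemma expand_cat y z : expand (y ++ z) = expand y ++ expand z.
Proof. by rewrite /expand map_cat flatten_cat. Qed.

Lemma expand_base m : expand (base_word m) = base_word m.
Proof. by rewrite /expand -map_comp; elim: m => //= i m ->. Qed.

Lemma expand_inr l : expand [:: inr l] = M l.1.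
Proof. by rewrite /expand /= cats0. Qed.

(** All three corners of the triangle at [x] expand to [M x]. *)
Lemma expand_edge e : expand (src e) = expand (tgt e).
Proof.
by case: e / edgeP => a b x s; rewrite src_whisker tgt_whisker !expand_cat;
  congr (_ ++ (_ ++ _)); rewrite ?src_einv ?tgt_einv /= /squier_src /squier_tgt /=;
  rewrite ?cats0 ?expand_base ?expand_inr.
Qed.

Lemma expand_path y z p : epath y p z -> expand y = expand z.
Proof.
elim: p y => [|e p IHp] y; first by move=> /eqP ->.
by move=> /andP[/eqP <- /IHp <-]; exact: expand_edge.
Qed.

Definition expansion_letter (c : letter) : seq (cedge K) :=
  match c with inl _ => [::] | inr l => [:: einv (collapse l.1 l.2)] end.

(** Letters are expanded from left to right: [z'] is still intact while [c] is treated, and [c] is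
    already expanded when [z'] is. *)
Fixpoint expansion z : seq (cedge K) :=
  if z is c :: z' then
    whiskerp [::] z' (expansion_letter c) ++ whiskerp (expand_letter c) [::] (expansion z')
  else [::].

Lemma expansion_cat y z :
  expansion (y ++ z) = whiskerp [::] z (expansion y) ++ whiskerp (expand y) [::] (expansion z).
Proof.
elim: y => [|c y IHy]; first by rewrite whiskerp0.
by rewrite /= IHy !whiskerp_cat !whiskerp_comp !cats0 -catA.
Qed.

Lemma expansion_base m : expansion (base_word m) = [::].
Proof. by elim: m => //= i m ->. Qed.

Lemma expansion_inr x s : expansion [:: inr (x, s)] = [:: einv (collapse x s)].
Proof. by rewrite /= whisker0. Qed.

Lemma epath_expansion z : epath z (expansion z) (expand z).
Proof.
elim: z => // c z IHz; rewrite -cat1s expansion_cat expand_cat.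
apply: epath_cat (_ : epath _ _ (expand [:: c] ++ z)) _; last first.
  by have := @epath_whisker P (expand [:: c]) [::] _ _ _ IHz; rewrite !cats0.
apply: (@epath_whisker P [::] z [:: c] (expand [:: c]) (expansion [:: c])).
case: c => [i|[x s]]; first exact: eqxx.
rewrite expansion_inr epath_cons epath_nil src_einv tgt_einv /=.
by rewrite /squier_src /squier_tgt /= cats0 expand_inr !eqxx.
Qed.

(** * From the Artin group to the diagram group *)

Definition triangle l : seq (cedge K) :=
  [:: collapse l.1 l.2; cross l.1 l.2; einv (collapse l.1 (~~ l.2))].

Lemma epath_triangle l : epath (M l.1) (triangle l) (M l.1).
Proof.
rewrite !epath_cons epath_nil src_einv tgt_einv /= /squier_src /squier_tgt /=.
by rewrite !cats0 !eqxx.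
Qed.

(** The sign of [l] is the direction in which the circle is run. *)
Lemma triangle_inv l : triangle (inv_letter l) = inv_path (triangle l).
Proof.
case: l => x s; rewrite /triangle /inv_path /inv_letter /= negbK /rev /=.
rewrite -[squier_inv (cross x s)]/(einv (cross x s)) cross_inv.
by rewrite squier_invK.
Qed.

Definition generator l : seq (cedge K) :=
  whiskerp (base_word (pre l.1)) (base_word (suf l.1)) (triangle l).

Definition realize (g : gword) : seq (cedge K) := flatten (map generator g).

Lemma factor_wordE x : base_word (pre x) ++ M x ++ base_word (suf x) = W.
Proof. by rewrite -!map_cat factorE. Qed.

Lemma epath_generator l : epath W (generator l) W.
Proof. by rewrite -(factor_wordE l.1); exact/(@epath_whisker P)/epath_triangle. Qed.

Lemma epath_realize g : epath W (realize g) W.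
Proof.
elim: g => [|l g IHg]; first exact: eqxx.
exact: epath_cat (epath_generator l) IHg.
Qed.

Lemma realize_cat g h : realize (g ++ h) = realize g ++ realize h.
Proof. by rewrite /realize map_cat flatten_cat. Qed.

Lemma realize1 l : realize [:: l] = generator l.
Proof. exact: cats0. Qed.

Lemma generator_inv l : generator (inv_letter l) = inv_path (generator l).
Proof. by rewrite /generator triangle_inv whiskerp_inv. Qed.

(** Adjacent vertices of [D] have factors without common letters, so [W] splits into two halves,
    each carrying one of the loops, and [interchange] applies. *)
Lemma generator_comm l l' : adj l.1 l'.1 ->
  path_homotopic W W (generator l ++ generator l') (generator l' ++ generator l).
Proof.
wlog ll' : l l' / size (pre l.1) <= size (pre l'.1) => [th|adjll'].
  have [ll'|/ltnW ll' adjll'] := leqP (size (pre l.1)) (size (pre l'.1)).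
    exact: th.
  by apply: rst_sym; apply: th ll' _; exact: adj_sym.
have disj := (adjE _ _).1 adjll'.
have E : pre l.1 ++ mid l.1 ++ suf l.1 = pre l'.1 ++ mid l'.1 ++ suf l'.1.
  by rewrite !factorE.
have [r [preE sufE]] := disjoint_factors (mid_nonempty (x := l'.1)) disj E ll'.
have tr a b l0 : epath (a ++ M l0.1 ++ b) (whiskerp a b (triangle l0)) (a ++ M l0.1 ++ b).
  exact/(@epath_whisker P)/epath_triangle.
have := @interchange P _ _ _ _ _ _ (tr (base_word (pre l.1)) [::] l)
  (tr (base_word r) (base_word (suf l'.1)) l').
rewrite !whiskerp_comp /generator preE sufE /base_word !map_cat !cats0 -!catA.
by rewrite -(factorE l.1) sufE !map_cat.
Qed.

Lemma generator_cancel l : path_homotopic W W (generator l ++ generator (inv_letter l)) [::].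
Proof. by rewrite generator_inv; exact: path_homotopic_inv (epath_generator l). Qed.

Lemma realize_eqv (g h : gword) : pres_eqv (@raag_relator D) g h ->
  path_homotopic W W (realize g) (realize h).
Proof.
elim=> {g h} [g h gh|g|g h _ gh|g h k _ gh _ hk]; last 3 first.
- exact: rst_refl.
- exact: rst_sym.
- exact: rst_trans gh hk.
(* Both kinds of step delete a factor [g2], so it suffices that [g2] is realized by a null-homotopic
   loop. *)
suff [g1 [g2 [g3 [-> -> H]]]] : exists g1 g2 g3, [/\ g = g1 ++ g2 ++ g3, h = g1 ++ g3 &
    path_homotopic W W (realize g2) [::]].
  rewrite !realize_cat.
  exact: path_homotopic_whisker (epath_realize g1) (epath_realize g3) H.
case: gh => [g1 g3 l|g1 g3 r [x [y [xy rE]]]].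
  exists g1, [:: l; inv_letter l], g3; split=> //.
  by rewrite -cat1s realize_cat !realize1; exact: generator_cancel.
exists g1, r, g3; split=> //; rewrite rE.
pose X := generator (x, false); pose Y := generator (y, false).
pose X' := generator (x, true); pose Y' := generator (y, true).
have -> : realize [:: (x, false); (y, false); (x, true); (y, true)] = (X ++ Y) ++ X' ++ Y'.
  by rewrite /X /Y /X' /Y' -!realize1 -!realize_cat.
(* Swapping [X] and [Y] turns the commutator into two nested cancelling pairs. *)
apply: rst_trans (_ : path_homotopic _ _ _ (Y ++ (X ++ X') ++ Y')) _.
  rewrite (_ : Y ++ (X ++ X') ++ Y' = (Y ++ X) ++ X' ++ Y'); last by rewrite -!catA.
  apply: path_homotopic_catr (generator_comm (l := (x, false)) (l' := (y, false)) xy).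
  exact: epath_cat (epath_generator _) (epath_generator _).
apply: rst_trans (generator_cancel (y, false)).
exact: (path_homotopic_whisker (epath_generator (y, false)) (epath_generator (y, true))
  (generator_cancel (x, false))).
Qed.

(** * From the diagram group to the Artin group *)

Definition edge_label e : gword :=
  if val e is (_, [:: inr l], [:: inr _], _) then [:: l] else [::].

Definition label p : gword := flatten (map edge_label p).

Lemma label_cat p q : label (p ++ q) = label p ++ label q.
Proof. by rewrite /label map_cat flatten_cat. Qed.

Lemma edge_label_whisker a b e : edge_label (whisker a b e) = edge_label e.
Proof. by case: e => [[[[? ?] ?] ?] ?]. Qed.

Lemma label_whisker a b p : label (whiskerp a b p) = label p.
Proof.
by rewrite /label /whiskerp -map_comp; congr flatten; apply: eq_map => e;
  exact: edge_label_whisker.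
Qed.

(** The sides at [M x] form a spanning tree of the triangle and carry no label. Even a one-letter
    [mid x] is not mistaken for a new letter, since its letter is an [inl]. *)
Lemma edge_label_collapse x s : edge_label (collapse x s) = [::].
Proof. by rewrite /edge_label /=; case: (mid x) => [|? []]. Qed.

Lemma edge_label_expand x s : edge_label (einv (collapse x s)) = [::].
Proof. by rewrite /edge_label /=; case: (mid x) => [|? []]. Qed.

Lemma edge_label_cross x s : edge_label (cross x s) = [:: (x, s)].
Proof. by []. Qed.

Definition edge_labelE := (edge_label_whisker, edge_label_collapse, edge_label_expand,
  edge_label_cross).

Lemma label_realize g : label (realize g) = g.
Proof.
elim: g => // -[x s] g IHg; rewrite -cat1s realize_cat label_cat IHg realize1.
by rewrite label_whisker /label [map _ _]/= !edge_labelE.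
Qed.

Lemma edge_label_inv e : edge_label (einv e) = map (@inv_letter D) (edge_label e).
Proof.
by case: e / edgeP => a b x s; rewrite whisker_inv ?einvK ?cross_inv !edge_labelE.
Qed.

Lemma edge_label_src e l : edge_label e = [:: l] ->
  exists a b t, val e = (a, [:: inr l], t, b).
Proof.
case: e / edgeP => a b x s; rewrite !edge_labelE // => -[<-].
by exists a, b, [:: inr (x, ~~ s)]; rewrite /= cats0.
Qed.

Lemma edge_label_cases e : edge_label e = [::] \/ exists l, edge_label e = [:: l].
Proof.
by case: e / edgeP => a b x s; rewrite !edge_labelE; [left|left|right; exists (x, s)].
Qed.

Local Notation eqv := (pres_eqv (@raag_relator D)).

Lemma letter_comm l l' : adj l.1 l'.1 -> eqv [:: l; l'] [:: l'; l].
Proof.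
(* The relators make only positive letters commute; commutation passes to inverses, one sign at a
   time. *)
have comm_inv (g h : gword) : eqv (g ++ h) (h ++ g) ->
    eqv (inv_gword g ++ h) (h ++ inv_gword g).
  move=> gh; apply: rst_trans (_ : eqv _ (inv_gword g ++ (h ++ g) ++ inv_gword g)) _.
    rewrite -[X in eqv X]cats0 -!catA; apply: pres_eqv_cat; first exact: rst_refl.
    by apply: pres_eqv_cat; [exact: rst_refl|exact/rst_sym/pres_mulrV].
  apply: rst_trans (_ : eqv _ (inv_gword g ++ (g ++ h) ++ inv_gword g)) _.
    apply: pres_eqv_cat; first exact: rst_refl.
    by apply: pres_eqv_cat; [exact: rst_sym|exact: rst_refl].
  rewrite -!catA catA.
  exact: (pres_eqv_cat (pres_mulV _ g) (rst_refl _ _ (h ++ inv_gword g))).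
case: l l' => [x s] [y t] /= xy.
have xy00 : eqv [:: (x, false); (y, false)] [:: (y, false); (x, false)].
  have H : eqv [:: (x, false); (y, false); (x, true); (y, true)] [::].
    have rel : raag_relator [:: (x, false); (y, false); (x, true); (y, true)].
      by exists x, y.
    exact: rst_step (PresRel [::] [::] rel).
  apply: rst_trans (pres_eqv_cat H (rst_refl _ _ [:: (y, false); (x, false)])).
  apply: rst_sym; exact: (pres_eqv_cat (rst_refl _ _ [:: (x, false); (y, false)])
    (pres_mulV _ [:: (y, false); (x, false)])).
have xy0 : eqv [:: (x, s); (y, false)] [:: (y, false); (x, s)].
  by case: s => //; exact: (comm_inv [:: (x, false)] [:: (y, false)]).
by case: t => //; apply: rst_sym; apply: (comm_inv [:: (y, false)] [:: (x, s)]);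
  exact: rst_sym.
Qed.

(** If both edges are crossings, the source of the square contains both new letters, so their
    factors sit at separate places of its expansion [W]. The letters of [W] are distinct, so these
    factors share none and the labels commute by [adjE]. *)
Lemma square_label e1 e2 f1 f2 : @square K e1 e2 f1 f2 -> expand (src e1) = W ->
  eqv (label [:: e1; e2]) (label [:: f1; f2]).
Proof.
move=> [a1 [u1 [v1 [a2 [u2 [v2 [a3 [E1 E2 F1 F2]]]]]]]] srcE.
(* Labels ignore contexts, and opposite sides of a square differ only by their contexts. *)
have -> : label [:: f1; f2] = label [:: e2; e1].
  by rewrite /label /= /edge_label E1 E2 F1 F2.
rewrite /label /= !cats0.
have [-> | [l le1]] := edge_label_cases e1; first by rewrite cats0; exact: rst_refl.
have [-> | [l' le2]] := edge_label_cases e2; first by rewrite cats0; exact: rst_refl.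
rewrite le1 le2; apply: letter_comm; apply/adjE.
have [? [? [? ]]] := edge_label_src le1; rewrite E1 => -[_ u1E _ _].
have [? [? [? ]]] := edge_label_src le2; rewrite E2 => -[_ u2E _ _].
have : uniq W by rewrite map_inj_uniq// => ? ? [].
rewrite -srcE /= /squier_src E1 u1E u2E !expand_cat !expand_inr.
rewrite cat_uniq => /and3P[_ _]; rewrite cat_uniq => /and3P[_ + _].
apply: contra => /hasP[i im' im]; apply/hasP; exists (inl i); last exact: map_f.
by rewrite !mem_cat map_f ?orbT.
Qed.

Lemma label_homotopic (p q : eloop (K := K) W) : homotopic p q ->
  eqv (label (val p)) (label (val q)).
Proof.
elim=> {p q} [p q pq|p|p q _ pq|p q r _ pq _ qr]; last 3 first.
- exact: rst_refl.
- exact: rst_sym.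
- exact: rst_trans pq qr.
case: pq (valP p) => [g h e _|g h e1 e2 f1 f2 sq /epath_catP[t gt /andP[/eqP tE _]]].
  rewrite !label_cat; apply: pres_eqv_cat; first exact: rst_refl.
  rewrite -[X in eqv _ X]cat0s; apply: pres_eqv_cat; last exact: rst_refl.
  rewrite /label /= cats0 edge_label_inv.
  have [-> | [l ->]] := edge_label_cases e; first exact: rst_refl.
  exact: (pres_mulrV _ [:: l]).
rewrite !label_cat; apply: pres_eqv_cat; first exact: rst_refl.
apply: pres_eqv_cat; last exact: rst_refl.
(* The part [g] of the loop joins [W] to the source of the square, whose expansion is therefore
   [W]. *)
by apply: square_label sq _; rewrite tE -(expand_path gt) expand_base.
Qed.

(** * Every loop is homotopic to the realization of its label *)

Variant basic_edge : cedge K -> Prop :=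
| BasicCollapse x s : basic_edge (collapse x s)
| BasicExpand x s : basic_edge (einv (collapse x s))
| BasicCross x s : basic_edge (cross x s).

Lemma edge_whisker e : exists a b e0, e = whisker a b e0 /\ basic_edge e0.
Proof.
by case: e / edgeP => a b x s; exists a, b; eexists; split=> //; constructor.
Qed.

(** Edges without context: the sides at [M x] are absorbed by the preferred paths, while a crossing
    is completed to a triangle. *)
Lemma basic_edge_expansion e : basic_edge e ->
  path_homotopic (src e) (expand (tgt e)) (e :: expansion (tgt e))
    (expansion (src e) ++ flatten (map triangle (edge_label e))).
Proof.
have srcE x s : src (collapse x s) = M x by rewrite /= /squier_src /= cats0.
have tgtE x s : tgt (collapse x s) = [:: inr (x, s)] by [].
have srcC x s : src (cross x s) = [:: inr (x, s)] by [].
have tgtC x s : tgt (cross x s) = [:: inr (x, ~~ s)] by [].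
have backtrack x s : path_homotopic (M x) (M x) [:: collapse x s; einv (collapse x s)] [::].
  apply: (path_homotopic_backtrack (p := [::]) (q := [::]));
  by rewrite epath_nil srcE.
case=> x s; rewrite edge_labelE.
- rewrite tgtE srcE expansion_inr expand_inr expansion_base; exact: backtrack.
- rewrite src_einv tgt_einv tgtE srcE expansion_inr expand_base expansion_base.
  exact: rst_refl.
- rewrite tgtC srcC !expansion_inr expand_inr.
  (* Read backwards, this inserts the backtrack [einv (collapse x s)], [collapse x s] before the
     crossing. *)
  apply: rst_sym.
  have := @path_homotopic_backtrack K [:: inr (x, s)] (M x) [::] (einv (collapse x s))
    [:: cross x s; einv (collapse x (~~ s))].
  rewrite einvK src_einv tgtE; apply; first exact: eqxx.
  by rewrite !epath_cons epath_nil !src_einv tgt_einv !tgtE srcC tgtC srcE !eqxx.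
Qed.

Lemma epath_label e : basic_edge e ->
  epath (expand (tgt e)) (flatten (map triangle (edge_label e))) (expand (tgt e)).
Proof.
case=> x s; rewrite edge_labelE; try exact: eqxx.
by rewrite -[tgt _]/[:: inr (x, ~~ s)] expand_inr; exact: (epath_triangle (x, s)).
Qed.

(** [M x] occurs only once in [W], so the contexts of a crossing at [x] can only expand to [pre x]
    and [suf x]: they have no influence on the generator obtained. *)
Lemma label_factor a b e : basic_edge e -> expand (a ++ src e ++ b) = W ->
  whiskerp (expand a) (expand b) (flatten (map triangle (edge_label e))) =
  realize (edge_label e).
Proof.
case=> x s; rewrite edge_labelE // realize1 -[src _]/[:: inr (x, s)].
rewrite -[flatten _]/(triangle (x, s)) !expand_cat expand_inr => abE.
have M0 : M x <> [::] by case: (mid x) (mid_nonempty (x := x)).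
have W_uniq : uniq W by rewrite map_inj_uniq// => ? ? [].
have [] := uniq_factor M0 _ (etrans abE (esym (factor_wordE x))).
  by rewrite abE.
by move=> -> ->.
Qed.

Lemma edge_expansion e : expand (src e) = W ->
  path_homotopic (src e) W (e :: expansion (tgt e))
    (expansion (src e) ++ realize (edge_label e)).
Proof.
move=> eW; have tW : expand (tgt e) = W by rewrite -expand_edge.
case: (edge_whisker e) eW tW => a [b [f [-> f_basic]]].
rewrite edge_label_whisker src_whisker tgt_whisker => eW tW.
rewrite -(label_factor f_basic eW).
set L := flatten _.
have core : path_homotopic (src f) (expand (tgt f)) (f :: expansion (tgt f))
  (expansion (src f) ++ L) := basic_edge_expansion f_basic.
have efE := expand_edge f.
have L_path : epath (expand (tgt f)) L (expand (tgt f)) := epath_label f_basic.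
have f_path : epath (src f ++ b) (whiskerp [::] b [:: f]) (tgt f ++ b).
  apply: (@epath_whisker P [::] b (src f) (tgt f) [:: f]).
  by rewrite epath_cons epath_nil !eqxx.
(* To the right of [f]: apply [core], then move the loop [L] past the expansion of [b]. *)
have inner : path_homotopic (src f ++ b) (expand (tgt f) ++ expand b)
    (whiskerp [::] b [:: f] ++ whiskerp [::] b (expansion (tgt f)) ++
       whiskerp (expand (tgt f)) [::] (expansion b))
    ((whiskerp [::] b (expansion (src f)) ++ whiskerp (expand (src f)) [::] (expansion b)) ++
       whiskerp [::] (expand b) L).
  have := @homotopic_whisker P [::] b _ _ _ _ core.
  rewrite -cat1s !whiskerp_cat efE catA => {}core.
  have tail := @epath_whisker P (expand (tgt f)) [::] _ _ _ (epath_expansion b).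
  rewrite !cats0 in tail.
  apply: rst_trans (path_homotopic_catr tail core) _; rewrite -!catA.
  apply: path_homotopic_catl (@interchange P _ _ _ _ _ _ L_path (epath_expansion b)).
  by have := @epath_whisker P [::] b _ _ _ (epath_expansion (src f)); rewrite efE.
have := @homotopic_whisker P (expand a) [::] _ _ _ _ inner.
have := @interchange P _ _ _ _ _ _ (epath_expansion a) f_path.
rewrite -tW !expand_cat !expansion_cat !cats0 whiskerp_cat => outer {}inner.
rewrite -cat1s -[[:: whisker a b f]]/(whiskerp a b [:: f]) (catA (whiskerp a b [:: f])).
have a_path : epath (a ++ src f ++ b) (whiskerp [::] (src f ++ b) (expansion a))
    (expand a ++ src f ++ b).
  exact: (@epath_whisker P [::] (src f ++ b) _ _ _ (epath_expansion a)).
(* To the left of [f]: the edge moves past the expansion of [a]. *)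
have {}outer : path_homotopic (a ++ src f ++ b) (expand a ++ tgt f ++ b)
    (whiskerp a b [:: f] ++ whiskerp [::] (tgt f ++ b) (expansion a))
    (whiskerp [::] (src f ++ b) (expansion a) ++
       whiskerp (expand a) [::] (whiskerp [::] b [:: f])).
  by apply: rst_sym; move: outer; rewrite [whiskerp a _ _]whiskerp_comp !cats0.
have tail := @epath_whisker P (expand a) [::] _ _ _ (epath_expansion (tgt f ++ b)).
rewrite expansion_cat expand_cat !cats0 in tail.
apply: rst_trans (path_homotopic_catr tail outer) _.
have := path_homotopic_catl a_path inner.
by rewrite !whiskerp_cat (@whiskerp_comp P _ _ [::] (expand b)) !cats0 -!catA.
Qed.

(** Each edge contributes its label by [edge_expansion]. For [y = W] the preferred path is empty,
    which gives the surjectivity of [realize] up to homotopy. *)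
Lemma path_expansion y p : epath y p W ->
  path_homotopic y W p (expansion y ++ realize (label p)).
Proof.
elim: p y => [|e p IHp] y.
  by move=> /eqP ->; rewrite expansion_base; exact: rst_refl.
move=> /andP[/eqP <- ep].
have srcE : expand (src e) = W by rewrite expand_edge (expand_path ep) expand_base.
apply: rst_trans (_ : path_homotopic _ _ _ (e :: expansion (tgt e) ++ realize (label p))) _.
  apply: (path_homotopic_catl (r := [:: e]) _ (IHp _ ep)).
  by rewrite epath_cons epath_nil !eqxx.
rewrite (_ : label (e :: p) = edge_label e ++ label p)// realize_cat catA.
exact: path_homotopic_catr (epath_realize _) (edge_expansion srcE).
Qed.

(** * The isomorphism and the conclusion for interval graphs *)

Lemma raag_factor_iso : group_iso (raag D) (@diagram_group P W).
Proof.
pose F (g : gword) : eloop (K := K) W := Sub (realize g) (epath_realize g).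
apply: (@group_quot_iso (presented_setoid (@raag_relator D)) (@loop_setoid K W)
  F (fun p : eloop (K := K) W => label (val p))).
- by move=> g h gh; apply: path_homotopic_loop; exact: realize_eqv.
- exact: label_homotopic.
- by move=> g h; apply: homotopic_val; rewrite /= realize_cat.
- by move=> g; rewrite /= label_realize; exact: rst_refl.
- move=> p; apply: path_homotopic_loop; apply: rst_sym.
  by have := path_expansion (valP p); rewrite expansion_base.
Qed.

End FactorPresentation.

Theorem theorem1p11 (R : realType) (G : simple_graph)
    (G_finite : finite_set [set: G]%classic) (G_interval : is_interval_graph R G) :
  is_diagram_group (raag (complement G)).
Proof.
have [A [w [pre [mid [suf [w_uniq w0 mid0 wE adjE]]]]]] :=
  interval_graph_factors G_finite G_interval.
have cadjE (x y : complement G) : adj x y <-> ~~ has (mem (mid x)) (mid y).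
  split=> [[xy nxy]|xy]; first by apply/negP => /(adjE _ _ xy).
  (* A nonempty factor shares letters with itself, so disjoint factors come from distinct
     vertices. *)
  have neq : x <> y.
    move=> E; move: xy; rewrite E; case: (mid y) (mid0 y) => //= a m _.
    by rewrite inE eqxx.
  by split=> // /(adjE _ _ neq); exact/negP.
exists (@factor_presentation A (complement G) mid mid0), (base_word (complement G) w).
split; first by case: w w0 {w_uniq wE}.
exact: (@raag_factor_iso A (complement G) w pre mid suf w_uniq mid0 wE cadjE).
Qed.
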